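(* Let $n\ge 3$. The projection map $\mathbb{A}^{(n+1)^3}\to\mathbb{A}^{n^2(n+1)/2}$ (from the affine space with coordinates $s_{ij}^k$, $0\le i,j,k\le n$, to the affine space with coordinates $t_{ij}^k$, $1\le i,j,k\le n$, $i\le j$) obtained by setting $$t_{ij}^k=s_{ij}^k\qquad 1\le i,j,k\le n,\ i\le j,$$ induces an isomorphism between $\mathfrak{B}_{n+1}^1$ and the closed subscheme of $\mathbb{A}^{n^2(n+1)/2}$ cut out by the ideal $$\mathfrak{J}\cap\Bbbk[t_{ij}^k\mid 1\le i,j,k\le n,\ i\le j].$$
   Context: $\Bbbk$ is a field of characteristic zero. $\mathfrak{B}_{n+1}^1$ is the moduli space of commutative, associative, unital $\Bbbk$-algebras of dimension $n+1$ with a fixed basis $v_0,\dots,v_n$ such that $v_0$ is the multiplicative identity. It is an affine scheme, viewed as a closed subscheme of $\mathbb{A}^{(n+1)^3}$ via the multiplication constants $s_{ij}^k$ ($0\le i,j,k\le n$), defined by $v_i\cdot v_j=\sum_{k=0}^n s_{ij}^k v_k$; that is, it is the closed subscheme whose ideal is given by the polynomial conditions on the $s_{ij}^k$ expressing commutativity, associativity, and that $v_0$ is the identity. $\Bbbk[[t_{ij}^k]]$ denotes the power series ring over $\Bbbk$ in the variables $t_{ij}^k$ with $1\le i,j,k\le n$, $i\le j$; one sets $t_{ij}^k=t_{ji}^k$ for $i>j$ (upper indices are not exponents). For $1\le i,j,k,\ell\le n$ define $$\gamma_{ijk}^\ell=\sum_{\lambda=1}^n \left(t_{ij}^{\lambda}t_{k\lambda}^{\ell}-t_{ik}^{\lambda}t_{j\lambda}^{\ell}\right).$$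 $\mathfrak{J}$ is the ideal of $\Bbbk[[t_{ij}^k]]$ generated by the $\gamma_{ijk}^{\ell}$ with $1\le i,j,k,\ell\le n$ and $j,k,\ell$ distinct, and the $\gamma_{ijk}^{k}-\gamma_{ij\ell}^{\ell}$ with $1\le i,j,k,\ell\le n$, $j\ne k$, $j\ne\ell$. *)

(* Defs.v *)
From HB Require Import structures.
From mathcomp Require Import all_boot all_order all_algebra.
From mathcomp Require Import boolp.
From mathcomp Require Import mpoly.

Set Implicit Arguments.
Unset Strict Implicit.
Unset Printing Implicit Defensive.

Import GRing.Theory.
Local Open Scope quotient_scope.
Local Open Scope ring_scope.

Section GeneratedIdeal.
Variable R : comNzRingType.
Implicit Types (G : R -> Prop) (x : R).

Definition ideal_gen G : {pred R} := fun x =>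
  `[< exists2 s : seq (R * R), (forall p, p \in s -> G p.2)
        & x = \sum_(p <- s) p.1 * p.2 >].

Lemma ideal_genP G x :
  reflect (exists2 s : seq (R * R), (forall p, p \in s -> G p.2)
             & x = \sum_(p <- s) p.1 * p.2) (x \in ideal_gen G).
Proof. exact: asboolP. Qed.

(* Properness is witnessed by a ring morphism, to a nonzero ring, that kills
   the generators. *)
Lemma ideal_gen_closed G (S : comNzRingType) (h : {rmorphism R -> S}) :
  (forall g, G g -> h g = 0) -> idealr_closed (ideal_gen G).
Proof.
move=> hG; split.
- by apply/ideal_genP; exists [::]; rewrite ?big_nil.
- apply/negP => /ideal_genP[s Gs] /(congr1 h).
  rewrite rmorph1 rmorph_sum big_seq big1 => [/eqP|p ps].
    by rewrite oner_eq0.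
  by rewrite rmorphM (hG p.2) ?mulr0 //; apply: Gs.
- move=> a u v /ideal_genP[s Gs ->] /ideal_genP[s' Gs' ->].
  apply/ideal_genP; exists ([seq (a * p.1, p.2) | p <- s] ++ s').
    move=> p; rewrite mem_cat => /orP[/mapP[q qs ->]|]; last exact: Gs'.
    exact: (Gs q).
  rewrite big_cat big_map mulr_sumr; congr (_ + _).
  by apply: eq_bigr => p _; rewrite mulrA.
Qed.

End GeneratedIdeal.

Section PowerSeries.
Variables (n : nat) (R : comNzRingType).

(* The formal power series with coefficient [mpscoef m] at the monomial m. *)
Record mpseries := MPSeries { mpscoef : 'X_{1..n} -> R }.

Implicit Types (f g h : mpseries) (m : 'X_{1..n}).

Lemma mpscoefK : cancel mpscoef MPSeries. Proof. by case. Qed.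

HB.instance Definition _ := Choice.copy mpseries (can_type mpscoefK).

Lemma mpsP f g : (forall m, mpscoef f m = mpscoef g m) -> f = g.
Proof. by move=> fg; apply: (can_inj mpscoefK); apply/funext. Qed.

Definition mps0 := MPSeries (fun=> 0).
Definition mps1 := MPSeries (fun m => (m == 0%MM)%:R).
Definition mpsN f := MPSeries (fun m => - mpscoef f m).
Definition mpsD f g := MPSeries (fun m => mpscoef f m + mpscoef g m).

Definition mpsM f g := MPSeries (fun m =>
  \sum_(k : 'X_{1..n < (mdeg m).+1, (mdeg m).+1} | m == (k.1 + k.2)%MM)
    mpscoef f k.1 * mpscoef g k.2).

Fact mpsDA : associative mpsD.
Proof. by move=> f g h; apply: mpsP => m /=; rewrite addrA. Qed.
Fact mpsDC : commutative mpsD.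
Proof. by move=> f g; apply: mpsP => m /=; rewrite addrC. Qed.
Fact mps0D : left_id mps0 mpsD.
Proof. by move=> f; apply: mpsP => m /=; rewrite add0r. Qed.
Fact mpsND : left_inverse mps0 mpsN mpsD.
Proof. by move=> f; apply: mpsP => m /=; rewrite addNr. Qed.

HB.instance Definition _ := GRing.isZmodule.Build mpseries mpsDA mpsDC mps0D mpsND.

Definition mpstrunc d f : {mpoly R[n]} :=
  \sum_(m : 'X_{1..n < d}) mpscoef f m *: 'X_[m].

Lemma mcoeff_mpstrunc d f m : (mdeg m < d)%N -> (mpstrunc d f)@_m = mpscoef f m.
Proof.
move=> md; rewrite /mpstrunc raddf_sum /= (bigD1 (BMultinom md)) //=.
rewrite mcoeffZ mcoeffX eqxx mulr1 big1 ?addr0 // => k kNm.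
by rewrite mcoeffZ mcoeffX (negPf (_ : bmnm k != m)) ?mulr0.
Qed.

Let mdeg_le_add m a b : m = (a + b)%MM -> (mdeg a <= mdeg m)%N /\ (mdeg b <= mdeg m)%N.
Proof. by move=> ->; rewrite mdegD leq_addr leq_addl. Qed.

Lemma mpscoefM d f g m : (mdeg m < d)%N ->
  mpscoef (mpsM f g) m = (mpstrunc d f * mpstrunc d g)@_m.
Proof.
move=> md; rewrite mcoeffM /=; apply: eq_bigr => k /eqP mE.
have [k1 k2] : (mdeg k.1 <= mdeg m)%N /\ (mdeg k.2 <= mdeg m)%N.
  exact: mdeg_le_add mE.
by rewrite !mcoeff_mpstrunc ?(leq_ltn_trans _ md).
Qed.

Lemma mcoeffM_eq d (p p' q q' : {mpoly R[n]}) m : (mdeg m < d)%N ->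
  (forall k, (mdeg k < d)%N -> p@_k = p'@_k) ->
  (forall k, (mdeg k < d)%N -> q@_k = q'@_k) -> (p * q)@_m = (p' * q')@_m.
Proof.
move=> md pp' qq'; rewrite !mcoeffM; apply: eq_bigr => k /eqP mE.
have [k1 k2] : (mdeg k.1 <= mdeg m)%N /\ (mdeg k.2 <= mdeg m)%N.
  exact: mdeg_le_add mE.
by rewrite pp' ?qq' ?(leq_ltn_trans _ md).
Qed.

Fact mpsMA : associative mpsM.
Proof.
move=> f g h; apply: mpsP => m.
have tM u v k : (mdeg k < (mdeg m).+1)%N ->
    (mpstrunc (mdeg m).+1 (mpsM u v))@_k =
    (mpstrunc (mdeg m).+1 u * mpstrunc (mdeg m).+1 v)@_k.
  by move=> km; rewrite mcoeff_mpstrunc // (mpscoefM _ _ km).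
rewrite !(mpscoefM _ _ (ltnSn (mdeg m))).
rewrite (mcoeffM_eq (ltnSn _) (fun _ _ => erefl) (tM g h)).
by rewrite (mcoeffM_eq (ltnSn _) (tM f g) (fun _ _ => erefl)) mulrA.
Qed.

Fact mpsMC : commutative mpsM.
Proof.
by move=> f g; apply: mpsP => m; rewrite !(mpscoefM _ _ (ltnSn (mdeg m))) mulrC.
Qed.

Fact mps1M : left_id mps1 mpsM.
Proof.
move=> f; apply: mpsP => m; rewrite (mpscoefM _ _ (ltnSn (mdeg m))).
have t1 k : (mdeg k < (mdeg m).+1)%N -> (mpstrunc (mdeg m).+1 mps1)@_k = 1@_k.
  by move=> km; rewrite mcoeff_mpstrunc // mcoeff1.
rewrite (mcoeffM_eq (ltnSn _) t1 (fun _ _ => erefl)) mul1r.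
by rewrite mcoeff_mpstrunc.
Qed.

Fact mpsMDl : left_distributive mpsM mpsD.
Proof.
move=> f g h; apply: mpsP => m /=; rewrite -big_split /=.
by apply: eq_bigr => k _; rewrite mulrDl.
Qed.

Fact mps1_neq0 : mps1 != mps0.
Proof.
apply/eqP => /(congr1 (fun f => mpscoef f 0%MM)) /= /eqP.
by rewrite eqxx oner_eq0.
Qed.

HB.instance Definition _ := GRing.Zmodule_isComNzRing.Build mpseries
  mpsMA mpsMC mps1M mpsMDl mps1_neq0.

Definition mps_of_mpoly (p : {mpoly R[n]}) : mpseries := MPSeries (fun m => p@_m).

Fact mps_of_mpoly_zmod : zmod_morphism mps_of_mpoly.
Proof. by move=> p q; apply: mpsP => m /=; rewrite mcoeffB. Qed.

Fact mps_of_mpoly_monoid : monoid_morphism mps_of_mpoly.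
Proof.
split=> [|p q]; apply: mpsP => m /=; first by rewrite mcoeff1.
by rewrite mcoeffM.
Qed.

HB.instance Definition _ :=
  GRing.isZmodMorphism.Build {mpoly R[n]} mpseries mps_of_mpoly mps_of_mpoly_zmod.
HB.instance Definition _ :=
  GRing.isMonoidMorphism.Build {mpoly R[n]} mpseries mps_of_mpoly mps_of_mpoly_monoid.

Definition mps_const f : R := mpscoef f 0%MM.

Fact mps_const_zmod : zmod_morphism mps_const.
Proof. by []. Qed.

Fact mps_const_monoid : monoid_morphism mps_const.
Proof.
split=> [|f g]; first by rewrite /mps_const /= eqxx.
have d0 : (mdeg (0%MM : 'X_{1..n}) < 1)%N by rewrite mdeg0.
by rewrite /mps_const (mpscoefM _ _ d0) rmorphM /= !mcoeff_mpstrunc.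
Qed.

HB.instance Definition _ :=
  GRing.isZmodMorphism.Build mpseries R mps_const mps_const_zmod.
HB.instance Definition _ :=
  GRing.isMonoidMorphism.Build mpseries R mps_const mps_const_monoid.

End PowerSeries.

Section PolynomialPart.
Variables (n : nat) (R : comNzRingType).

(* The intersection with the polynomial ring, along the inclusion
   [mps_of_mpoly]. *)
Definition polypart (J : {pred mpseries n R}) : {pred {mpoly R[n]}} :=
  fun p => mps_of_mpoly p \in J.

Fact polypart_closed (J : idealr (mpseries n R)) : idealr_closed (polypart J).
Proof.
split=> [||a u v uJ vJ]; rewrite unfold_in.
- by rewrite rmorph0 idealr0.
- by rewrite rmorph1 idealr1.
- by rewrite rmorphD rmorphM rpredD // idealMr.
Qed.

HB.instance Definition _ (J : idealr (mpseries n R)) :=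
  isIdealr.Build {mpoly R[n]} (polypart J) (polypart_closed J).

End PolynomialPart.

(* The affine space with coordinates indexed by a finite type I has coordinate
   ring {mpoly k[#|I|]}; the coordinate x is the following variable. *)
Definition coordX (k : fieldType) (I : finType) (x : I) : {mpoly k[#|I|]} :=
  'X_(enum_rank x).

(* A closed subscheme of affine space is given by its ideal X and has
   coordinate ring {ideal_quot X}.  A morphism from affine M-space to affine
   N-space is given by its N component polynomials f, and its comorphism is
   [comp_mpoly f].  It induces an isomorphism from V(X) to V(Y) when this
   comorphism passes to the quotients and is then an isomorphism from the
   coordinate ring of V(Y) to that of V(X); such an isomorphism is k-linear,
   being induced by a k-linear map. *)
Definition induces_iso (k : fieldType) (M N : nat) (f : N.-tuple {mpoly k[M]})
    (X : idealr {mpoly k[M]}) (Y : idealr {mpoly k[N]}) : Prop :=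
  exists2 phi : {rmorphism {ideal_quot Y} -> {ideal_quot X}},
    forall p, phi (\pi_{ideal_quot Y} p) = \pi_{ideal_quot X} (comp_mpoly f p)
    & bijective phi.

Section BasedAlgebras.
Variables (k : fieldType) (n : nat).

Definition svar : finType := ('I_n.+1 * 'I_n.+1 * 'I_n.+1)%type.

Lemma card_svar : #|svar| = (n.+1 ^ 3)%N.
Proof. by rewrite !card_prod !card_ord !expnS expn0 muln1 mulnA. Qed.

Definition sX (i j l : 'I_n.+1) : {mpoly k[#|svar|]} := coordX k ((i, j, l) : svar).

Variant based_algebra_eqn : {mpoly k[#|svar|]} -> Prop :=
  | BA_comm i j l : based_algebra_eqn (sX i j l - sX j i l)
  | BA_assoc i j l m : based_algebra_eqn
      (\sum_a sX i j a * sX a l m - \sum_a sX j l a * sX i a m)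
  | BA_unitl j l : based_algebra_eqn (sX ord0 j l - (j == l)%:R)
  | BA_unitr i l : based_algebra_eqn (sX i ord0 l - (i == l)%:R).

Definition based_algebra_ideal : {pred {mpoly k[#|svar|]}} :=
  ideal_gen based_algebra_eqn.

(* The point at which all products of v_1, ..., v_n vanish. *)
Let pt (x : svar) : k :=
  if x.1.1 == ord0 then (x.1.2 == x.2)%:R
  else if x.1.2 == ord0 then (x.1.1 == x.2)%:R else 0.

Let pt_sX i j l :
  (sX i j l).@[fun r => pt (enum_val r)] = pt (i, j, l).
Proof. by rewrite mevalXU enum_rankK. Qed.

Let pt_comm i j l : pt (i, j, l) = pt (j, i, l).
Proof.
rewrite /pt /=; case: (eqVneq i ord0) => [->|//].
by case: (eqVneq j ord0) => [->|//].
Qed.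

Let pt_unit j l : pt (ord0, j, l) = (j == l)%:R.
Proof. by rewrite /pt. Qed.

Let sum_delta j (F : 'I_n.+1 -> k) : \sum_a (j == a)%:R * F a = F j.
Proof.
rewrite (bigD1 j) //= eqxx mul1r big1 ?addr0 // => a aj.
by rewrite eq_sym (negPf aj) mul0r.
Qed.

Let pt_assoc i j l m :
  \sum_a pt (i, j, a) * pt (a, l, m) = \sum_a pt (j, l, a) * pt (i, a, m).
Proof.
have [->|i0] := eqVneq i ord0.
  under eq_bigr do rewrite pt_unit.
  under [RHS]eq_bigr do rewrite pt_unit mulrC eq_sym.
  by rewrite !sum_delta.
have [->|l0] := eqVneq l ord0.
  under eq_bigr do rewrite pt_comm (pt_comm _ ord0) -pt_comm pt_unit mulrC eq_sym.
  under [RHS]eq_bigr do rewrite pt_comm pt_unit.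
  by rewrite !sum_delta.
have [->|j0] := eqVneq j ord0.
  under eq_bigr do rewrite pt_comm pt_unit.
  under [RHS]eq_bigr do rewrite pt_unit.
  by rewrite !sum_delta.
by rewrite !big1 // => a _; rewrite {1}/pt /= ?(negPf i0) (negPf j0) ?(negPf l0) mul0r.
Qed.

Fact based_algebra_ideal_closed : idealr_closed based_algebra_ideal.
Proof.
apply: (ideal_gen_closed (h := meval (fun r => pt (enum_val r)))) => _ [].
- by move=> i j l; rewrite rmorphB /= !pt_sX pt_comm subrr.
- move=> i j l m; rewrite rmorphB !rmorph_sum /=.
  under eq_bigr do rewrite rmorphM /= !pt_sX.
  under [X in _ - X]eq_bigr do rewrite rmorphM /= !pt_sX.
  by rewrite pt_assoc subrr.
- by move=> j l; rewrite rmorphB rmorph_nat /= pt_sX pt_unit subrr.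
- by move=> i l; rewrite rmorphB rmorph_nat /= pt_sX pt_comm pt_unit subrr.
Qed.

HB.instance Definition _ := isIdealr.Build {mpoly k[#|svar|]} based_algebra_ideal
  based_algebra_ideal_closed.

(* The t-indices run over 1, ..., n: i : 'I_n stands for i + 1. *)
Definition tle (x : 'I_n * 'I_n * 'I_n) := (x.1.1 <= x.1.2)%N.

Definition tvar : finType := {x | tle x}.

Lemma card_tvar : (#|tvar| * 2 = n ^ 2 * n.+1)%N.
Proof.
have -> : #|tvar| = (\sum_(l < n) \sum_(j < n) \sum_(i < n) (i <= j))%N.
  rewrite card_sig -sum1_card big_mkcond /=.
  rewrite -(pair_bigA _ (fun p l => if tle (p, l) then 1 else 0)%N) /= exchange_big.
  apply: eq_bigr => l _.
  rewrite -(pair_bigA _ (fun i j => if tle (i, j, l) then 1 else 0)%N) /= exchange_big.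
  by do 2!apply: eq_bigr => ? _; rewrite /tle /=; case: leq.
rewrite big_const_ord iter_addn_0.
have lej (j : 'I_n) : (\sum_(i < n) (i <= j) = j.+1)%N.
  rewrite -(big_mkord xpredT (fun i => (i <= j : nat)))%N.
  rewrite (big_cat_nat _ (n := j.+1)) //=.
  rewrite [X in (_ + X)%N]big_nat [X in (_ + X)%N]big1 => [|i /andP[ji _]].
    rewrite addn0 big_nat (eq_bigr (fun=> 1%N)) => [|i /andP[_ ij]].
      by rewrite -big_nat sum_nat_const_nat subn0 muln1.
    by rewrite -ltnS ij.
  by rewrite leqNgt ji.
rewrite (eq_bigr (fun j : 'I_n => j + 1)%N) => [|j _]; last by rewrite lej addn1.
rewrite big_split /= sum1_card card_ord -(big_mkord xpredT id) /= bin2_sum.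
rewrite mulnAC mulnDl (bin_ffact n 2) ffactnS ffactn1 -mulnDr -mulnn.
by rewrite mulnAC; case: (n) => // p; rewrite /= addn2.
Qed.

Definition tsort (i j l : 'I_n) := if (i <= j)%N then (i, j, l) else (j, i, l).

Fact tsortP i j l : tle (tsort i j l).
Proof. by rewrite /tle /tsort; case: (leqP i j) => //= /ltnW. Qed.

Definition tidx (i j l : 'I_n) : tvar := exist _ (tsort i j l) (tsortP i j l).

Definition tX (i j l : 'I_n) : mpseries #|tvar| k :=
  mps_of_mpoly (coordX k (tidx i j l)).

Definition gamma (i j l m : 'I_n) : mpseries #|tvar| k :=
  \sum_a (tX i j a * tX l a m - tX i l a * tX j a m).

Variant Jgen : mpseries #|tvar| k -> Prop :=
  | Jgen_distinct i j l m :
      j != l -> j != m -> l != m -> Jgen (gamma i j l m)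
  | Jgen_diff i j l m :
      j != l -> j != m -> Jgen (gamma i j l l - gamma i j m m).

Definition Jideal : {pred mpseries #|tvar| k} := ideal_gen Jgen.

Fact Jideal_closed : idealr_closed Jideal.
Proof.
have t0 (x : tvar) : (coordX k x)@_0 = 0 by rewrite mcoeffX mnm1_eq0.
have g0 i j l m : mps_const (gamma i j l m) = 0.
  rewrite rmorph_sum big1 // => a _.
  by rewrite rmorphB !rmorphM /= !t0 !mul0r subrr.
apply: (ideal_gen_closed (h := @mps_const _ _)) => _ [] i j l m *.
  exact: g0.
by rewrite rmorphB /= !g0 subrr.
Qed.

HB.instance Definition _ :=
  isIdealr.Build (mpseries #|tvar| k) Jideal Jideal_closed.

Definition st_proj : #|tvar|.-tuple {mpoly k[#|svar|]} :=
  [tuple let x := val (enum_val r) in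
         sX (lift ord0 x.1.1) (lift ord0 x.1.2) (lift ord0 x.2) | r < #|tvar|].

End BasedAlgebras.

Arguments based_algebra_ideal : clear implicits.
Arguments Jideal : clear implicits.

(* Main.v *)
From HB Require Import structures.
Require Import Defs.
From mathcomp Require Import all_boot all_order all_algebra.
From mathcomp Require Import mpoly ring.
Import GRing.Theory.
Local Open Scope ring_scope.
Set Implicit Arguments.
Unset Strict Implicit.

(** Both schemes have the same points in every commutative ring R, naturally
in R.

Let v_0 = 1, v_1, ..., v_n be a based algebra with structure constants s, and
let t be the part of s with all indices positive.  Comparing coefficients of
v_m, m > 0, in (v_i v_j) v_l = (v_i v_l) v_j gives [balg_gammaT]:
   gamma_ijl^m = s_il^0 delta_jm - s_ij^0 delta_lm.
Hence gamma_ijl^m = 0 for j, l, m distinct, and gamma_ijl^l = - s_ij^0 for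
every l different from j.  So t satisfies the relations that generate J, and
the unit coefficients s_ij^0 are polynomials in t.

Conversely, given t that satisfies these relations, define s_ij^0 by
- gamma_ijl^l.  Three conditions remain: symmetry of s^0, associativity in
the coefficients of v_m for m > 0, and associativity in the coefficient of v_0.
Symmetry is the relation gamma_lji^l = 0 with i, j, l distinct.  The second
condition is the displayed formula again.  The third is cubic in t; it follows
from the Jacobi identity for the multiplication matrices M_j = (t_ij^m)_(i,m).
Indeed the formula says that [M_j, M_l] is a sum of two rank one matrices, and
a column of the Jacobi identity of M_j, M_l, M_k with k different from j and
l is exactly the wanted relation [unit_coef_assoc].  The inequality n >= 3
provides this k.

Passing from power series to polynomials loses nothing because the generators
of J are homogeneous: if a polynomial p is a combination of them over the power
series ring, then each homogeneous component of p is a combination of them over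
the polynomial ring.  This is used in the form [kill_polypart]: a ring morphism
on polynomials that kills the generators kills all of the contraction of J.

The isomorphism of coordinate rings is then obtained from two morphisms of
polynomial rings, the comorphism of the projection and that of the polynomial
map [ts_section] which adjoins a unit, by applying the two constructions above
to the universal points in the two quotient rings. *)

(** * Homogeneous ideals and power series *)

Section GradedIdeals.
Variables (n : nat) (R S : comNzRingType) (h : {rmorphism {mpoly R[n]} -> S}).

Lemma pihomog_eq d (p q : {mpoly R[n]}) :
  (forall m, mdeg m = d -> p@_m = q@_m) -> pihomog mdeg d p = pihomog mdeg d q.
Proof.
move=> pq; rewrite (pihomogwE _ _ (leq_maxl (msize p) (msize q))).
rewrite (pihomogwE _ _ (leq_maxr (msize p) (msize q))).
by apply: eq_bigr => m /eqP md; rewrite pq.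
Qed.

(** Truncating at degree d.+1 first makes the homogeneous component of degree d
of a power series the component of a polynomial. *)
Definition mps_part d (f : mpseries n R) : {mpoly R[n]} :=
  pihomog mdeg d (mpstrunc d.+1 f).

Lemma mps_part0 d : mps_part d 0 = 0.
Proof.
by rewrite /mps_part /mpstrunc big1 ?pihomog0 // => m _; rewrite scale0r.
Qed.

Lemma mps_partD d f g : mps_part d (f + g) = mps_part d f + mps_part d g.
Proof.
rewrite /mps_part -raddfD /= /mpstrunc -big_split /=; congr pihomog.
by apply: eq_bigr => m _; rewrite -scalerDl.
Qed.

Lemma mps_part_mpoly d p : mps_part d (mps_of_mpoly p) = pihomog mdeg d p.
Proof. by apply: pihomog_eq => m md; rewrite mcoeff_mpstrunc ?md. Qed.

Lemma mps_partM d f p :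
  mps_part d (f * mps_of_mpoly p) = pihomog mdeg d (mpstrunc d.+1 f * p).
Proof.
apply: pihomog_eq => m md; have md' : (mdeg m < d.+1)%N by rewrite md.
rewrite mcoeff_mpstrunc // (mpscoefM _ _ md').
apply: mcoeffM_eq md' _ _ => // k kd.
by rewrite mcoeff_mpstrunc.
Qed.

(** Multiplying the homogeneous components of p by g gives the homogeneous
components of p * g, with degrees shifted by d. *)
Lemma kill_pihomogM d e p g :
  g \is d.-homog -> h g = 0 -> h (pihomog mdeg e (p * g)) = 0.
Proof.
move=> gd hg; rewrite [p](pihomog_partitionE (leqnn (msize p))).
rewrite mulr_suml (raddf_sum (pihomog mdeg e)) (raddf_sum h) big1 // => c _ /=.
have cg : pihomog mdeg c p * g \is (c + d).-homog.
  by apply: dhomogM gd; apply: pihomogP.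
have [<-|cde] := eqVneq (c + d)%N e.
  by rewrite pihomog_dE // rmorphM hg mulr0.
by rewrite (pihomog_ne0 cde cg) rmorph0.
Qed.

(** In each degree e, a combination of homogeneous polynomials with power series
coefficients involves finitely many coefficients of those series, hence agrees
with a combination over the polynomial ring.  Stating this through a morphism h
avoids exhibiting the latter combination. *)
Lemma kill_polypart (G : mpseries n R -> Prop) p :
  (forall f, G f ->
    exists g d, [/\ f = mps_of_mpoly g, g \is d.-homog & h g = 0]) ->
  mps_of_mpoly p \in ideal_gen G -> h p = 0.
Proof.
move=> GP /ideal_genP[s sG ps].
rewrite [p](pihomog_partitionE (leqnn (msize p))) raddf_sum big1 // => e _ /=.
rewrite -mps_part_mpoly ps; elim: s sG {ps} => [|[a f] s IHs] sG.
  by rewrite big_nil mps_part0 rmorph0.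
rewrite big_cons mps_partD rmorphD IHs ?addr0 => [|q qs]; last first.
  by apply: sG; rewrite inE qs orbT.
have [g [d [/= -> gd hg]]] := GP f (sG (a, f) (mem_head _ _)).
by rewrite mps_partM (kill_pihomogM _ _ gd).
Qed.

End GradedIdeals.

(** * Morphisms of quotient rings *)
Section QuotientMorphisms.
Variables (R S : comNzRingType).

Lemma kill_ideal_gen (h : {rmorphism R -> S}) (G : R -> Prop) x :
  (forall g, G g -> h g = 0) -> x \in ideal_gen G -> h x = 0.
Proof.
move=> hG /ideal_genP[s sG ->]; rewrite rmorph_sum big_seq big1 // => p ps.
by rewrite rmorphM (hG _ (sG _ ps)) mulr0.
Qed.

(** The projection with its ring morphism structure made part of its type. *)
Definition pi_ideal (I : idealr R) : {rmorphism R -> {ideal_quot I}} :=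
  \pi_{ideal_quot I}%qT.

Lemma pi_ideal_eq0 (I : idealr R) x : (x \in I) = (pi_ideal I x == 0).
Proof.
rewrite -[x in LHS]subr0 (Quotient.idealrBE I).
by rewrite -[0 in RHS](rmorph0 (pi_ideal I)).
Qed.

Lemma pi_ideal_surj (I : idealr R) (x : {ideal_quot I}) :
  exists y, x = pi_ideal I y.
Proof. by exists (repr x); rewrite /= reprK. Qed.

Definition quot_lift (I : idealr R) (h : {rmorphism R -> S})
  (hI : forall x, x \in I -> h x = 0) : {ideal_quot I} -> S := fun x => h (repr x).

Variables (I : idealr R) (h : {rmorphism R -> S}).
Hypothesis hI : forall x, x \in I -> h x = 0.

Lemma quot_lift_pi x : quot_lift hI (\pi_{ideal_quot I}%qT x) = h x.
Proof.
apply/eqP; rewrite -subr_eq0 -rmorphB hI // (Quotient.idealrBE I).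
by rewrite reprK.
Qed.

Fact quot_lift_zmod : zmod_morphism (quot_lift hI).
Proof.
by elim/quotP=> x _; elim/quotP=> y _; rewrite -rmorphB !quot_lift_pi rmorphB.
Qed.

Fact quot_lift_monoid : monoid_morphism (quot_lift hI).
Proof.
split.
  by rewrite -(rmorph1 \pi_{ideal_quot I}%qT) quot_lift_pi rmorph1.
by elim/quotP=> x _; elim/quotP=> y _; rewrite -rmorphM !quot_lift_pi rmorphM.
Qed.

HB.instance Definition _ :=
  GRing.isZmodMorphism.Build {ideal_quot I} S (quot_lift hI) quot_lift_zmod.
HB.instance Definition _ :=
  GRing.isMonoidMorphism.Build {ideal_quot I} S (quot_lift hI) quot_lift_monoid.

End QuotientMorphisms.

Lemma mpoly_rmorph_eq n (R S : comNzRingType)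
    (f g : {rmorphism {mpoly R[n]} -> S}) :
  (forall c, f c%:MP = g c%:MP) -> (forall i, f 'X_i = g 'X_i) -> f =1 g.
Proof.
move=> fgC fgX p; rewrite [p]mpolyE !raddf_sum; apply: eq_bigr => m _.
rewrite -!mul_mpolyC /= (rmorphM f) (rmorphM g) fgC mpolyXE_id.
rewrite (rmorph_prod f) (rmorph_prod g); congr (_ * _).
by apply: eq_bigr => i _; rewrite (rmorphXn f) (rmorphXn g) fgX.
Qed.

(** * Based algebras and the gamma relations over a ring *)
Lemma exists_third n (i j : 'I_n) : (2 < n)%N -> exists l, l != i /\ l != j.
Proof.
move=> n3; have : (0 < #|~: [set i; j]|)%N.
  have := cardsC [set i; j]; rewrite card_ord cards2.
  by case: #|_| => // nE; move: n3; rewrite -nE addn0; case: (i != j).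
by case/card_gt0P => l; rewrite !inE negb_or => /andP[li lj]; exists l.
Qed.

Lemma mulmx_jacobi (R : comNzRingType) n (A B C : 'M[R]_n) :
  let br (X Y : 'M[R]_n) := X *m Y - Y *m X in
  br (br A B) C + br (br B C) A + br (br C A) B = 0.
Proof.
rewrite /= !mulmxBl !mulmxBr !mulmxA; apply/matrixP => i j; rewrite !mxE; ring.
Qed.

Section StructureConstants.
Variables (R : comNzRingType) (n : nat).
Hypothesis n3 : (2 < n)%N.
Implicit Types (s : 'I_n.+1 -> 'I_n.+1 -> 'I_n.+1 -> R).
Implicit Types (T : 'I_n -> 'I_n -> 'I_n -> R).

(** The coefficient of v_m in (v_i v_j) v_l - (v_i v_l) v_j when the products of
the v_i, i > 0, have structure constants T and no component on the unit. *)
Definition gammaT T i j l m := \sum_a (T i j a * T l a m - T i l a * T j a m).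

(** The points of the moduli scheme of based algebras with values in R. *)
Record based_algebra s : Prop := BasedAlgebra {
  balg_comm : forall i j l, s i j l = s j i l;
  balg_assoc : forall i j l m,
    \sum_a s i j a * s a l m = \sum_a s j l a * s i a m;
  balg_unit : forall j l, s ord0 j l = (j == l)%:R }.

(** The points with values in R of the scheme cut out by the generators of J. *)
Record gamma_relations T : Prop := GammaRelations {
  gamma_sym : forall i j l, T i j l = T j i l;
  gamma_distinct : forall i j l m,
    j != l -> j != m -> l != m -> gammaT T i j l m = 0;
  gamma_diff : forall i j l m,
    j != l -> j != m -> gammaT T i j l l = gammaT T i j m m }.

Definition nonunit_part s : 'I_n -> 'I_n -> 'I_n -> R :=
  fun i j l => s (lift ord0 i) (lift ord0 j) (lift ord0 l).

(** The coefficient of v_0 in v_i v_j.  Any l different from j gives the same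
value under the gamma relations, as [unit_coefE] shows. *)
Definition unit_coef T i j : R :=
  let l := odflt j [pick l | l != j] in - gammaT T i j l l.

(** The structure constants of R v_0 + ... + R v_n; index 0, which belongs to the
unit, is recognized as the index outside the image of [lift ord0]. *)
Definition adjoin_unit T : 'I_n.+1 -> 'I_n.+1 -> 'I_n.+1 -> R := fun i j l =>
  match unlift ord0 i, unlift ord0 j with
  | None, _ => (j == l)%:R
  | _, None => (i == l)%:R
  | Some i', Some j' =>
    if unlift ord0 l is Some l' then T i' j' l' else unit_coef T i' j'
  end.

Lemma gammaT_antisym T i j l m : gammaT T i l j m = - gammaT T i j l m.
Proof. by rewrite /gammaT -sumrN; apply: eq_bigr => a _; rewrite opprB. Qed.

Lemma gammaT_diag T i j m : gammaT T i j j m = 0.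
Proof. by rewrite /gammaT big1 // => a _; rewrite subrr. Qed.

(** Associativity and commutativity give (v_j v_i) v_l = v_j (v_i v_l), and the
two terms on the right come from the components of v_i v_l and v_i v_j on the
unit. *)
Lemma balg_gammaT s i j l m : based_algebra s ->
  gammaT (nonunit_part s) i j l m =
    s (lift ord0 i) (lift ord0 l) ord0 * (j == m)%:R
    - s (lift ord0 i) (lift ord0 j) ord0 * (l == m)%:R.
Proof.
move=> [sC sA s1].
have := sA (lift ord0 j) (lift ord0 i) (lift ord0 l) (lift ord0 m).
rewrite !big_ord_recl s1 (sC _ ord0) s1 !(inj_eq (@lift_inj _ _)) => eqA.
rewrite /gammaT /nonunit_part sumrB (sC (lift ord0 i) (lift ord0 j)).
under eq_bigr do rewrite (sC (lift ord0 i) (lift ord0 j)) (sC (lift ord0 l)).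
by apply/eqP; rewrite subr_eq addrAC -eqA addrAC subrr add0r.
Qed.

Lemma balg_gamma_relations s :
  based_algebra s -> gamma_relations (nonunit_part s).
Proof.
move=> sB; split=> [i j l|i j l m jl jm lm|i j l m jl jm].
- by rewrite /nonunit_part (balg_comm sB).
- by rewrite balg_gammaT // (negPf jm) (negPf lm) !mulr0 subrr.
- by rewrite !balg_gammaT // (negPf jl) (negPf jm) !eqxx !mulr0.
Qed.

Lemma unit_coefE T i j l : gamma_relations T -> l != j ->
  unit_coef T i j = - gammaT T i j l l.
Proof.
move=> TJ lj; rewrite /unit_coef; case: pickP => [l' l'j|/(_ l)]; last first.
  by rewrite lj.
by congr (- _); apply: (gamma_diff TJ); rewrite eq_sym.
Qed.

(** A based algebra is determined by its constants with positive indices. *)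
Lemma adjoin_nonunit_part s : based_algebra s ->
  forall i j l, adjoin_unit (nonunit_part s) i j l = s i j l.
Proof.
move=> sB i j l; rewrite /adjoin_unit.
case: (unliftP ord0 i) => [i'|] ->; last by rewrite (balg_unit sB).
case: (unliftP ord0 j) => [j'|] ->.
  case: (unliftP ord0 l) => [l'|] -> //.
  have [a [aj _]] := exists_third j' j' n3.
  rewrite (unit_coefE _ (balg_gamma_relations sB) aj) balg_gammaT // eqxx.
  by rewrite eq_sym (negPf aj) mulr0 mulr1 sub0r opprK.
by rewrite (balg_comm sB) (balg_unit sB).
Qed.

Section AdjoinUnit.
Variable T : 'I_n -> 'I_n -> 'I_n -> R.
Hypothesis TJ : gamma_relations T.
Let TC := gamma_sym TJ.

(** For l different from i and j, the difference of the two coefficients is an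
entry of gamma with three distinct indices, by symmetry of T. *)
Lemma unit_coef_sym i j : unit_coef T i j = unit_coef T j i.
Proof.
have [-> //|ij] := eqVneq i j.
have [l [li lj]] := exists_third i j n3.
rewrite (unit_coefE _ TJ lj) (unit_coefE _ TJ li).
apply/eqP; rewrite eqr_opp -subr_eq0; apply/eqP.
have <- : gammaT T l j i l = gammaT T i j l l - gammaT T j i l l; last first.
  by apply: gamma_distinct; rewrite // eq_sym.
rewrite /gammaT -sumrB; apply: eq_bigr => a _.
rewrite (TC j i) (TC l j) (TC l i); ring.
Qed.

(** This is the formula of [balg_gammaT], recovered from the gamma relations. *)
Lemma gammaTE i j l m :
  gammaT T i j l m = unit_coef T i l * (j == m)%:R - unit_coef T i j * (l == m)%:R.
Proof.
have [->|jl] := eqVneq j l; first by rewrite gammaT_diag subrr.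
have [jm|jm] := eqVneq j m; have [lm|lm] := eqVneq l m.
- by rewrite jm lm eqxx in jl.
- by rewrite -jm (unit_coefE _ TJ jl) gammaT_antisym mulr1 mulr0 subr0.
- have lj : l != j by rewrite eq_sym.
  by rewrite -lm (unit_coefE _ TJ lj) mulr0 sub0r mulr1 opprK.
- by rewrite (gamma_distinct TJ) // !mulr0 subrr.
Qed.

(** M j is multiplication by v_j, followed by projection along the unit, acting
on row vectors; S j collects the components on the unit. *)
Let M j : 'M[R]_n := \matrix_(i, m) T i j m.
Let S j : 'cV[R]_n := \col_i unit_coef T i j.

(** The matrix form of [gammaTE]. *)
Lemma bracket_mul j l :
  M j *m M l - M l *m M j = S l *m delta_mx 0 j - S j *m delta_mx 0 l.
Proof.
apply/matrixP => i m; rewrite !mxE !big_ord1 !mxE /=.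
rewrite ![m == _]eq_sym -gammaTE /gammaT sumrB.
by congr (_ - _); apply: eq_bigr => a _; rewrite !mxE (TC a).
Qed.

(** Associativity in the component on the unit.  Expanding the Jacobi identity
with [bracket_mul], the terms S a *m delta_mx 0 b *m M c cancel in pairs since
delta_mx 0 b *m M c is symmetric in b and c.  What remains is a sum of three
rank one matrices with distinct nonzero columns j, l and k, so each of them
vanishes. *)
Lemma unit_coef_assoc i j l :
  \sum_a T i j a * unit_coef T a l = \sum_a T i l a * unit_coef T a j.
Proof.
have [->//|jl] := eqVneq j l.
have [k [kj kl]] := exists_third j l n3.
have eM a b : delta_mx 0 a *m M b = delta_mx 0 b *m M a :> 'rV_n.
  by rewrite -!rowE; apply/rowP => c; rewrite !mxE TC.
have MSE a b : (M a *m S b) i 0 = \sum_c T i a c * unit_coef T c b.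
  by rewrite mxE; apply: eq_bigr => c _; rewrite !mxE.
have : (M j *m S l - M l *m S j) *m delta_mx 0 k
     + (M l *m S k - M k *m S l) *m delta_mx 0 j
     + (M k *m S j - M j *m S k) *m delta_mx 0 l = 0.
  rewrite -(mulmx_jacobi (M j) (M l) (M k)) /= !bracket_mul !mulmxBl !mulmxBr.
  rewrite -!(mulmxA (S _)) (eM l j) (eM k j) (eM k l) !mulmxA.
  (* The matrix products are generalized so that expanding entries stops at them. *)
  move: (S j *m _ *m _) (S k *m _ *m _) (S l *m _ *m _) => P1 P2 P3.
  move: (M j *m S l *m _) (M l *m S j *m _) (M l *m S k *m _) => Q1 Q2 Q3.
  move: (M k *m S l *m _) (M k *m S j *m _) (M j *m S k *m _) => Q4 Q5 Q6.
  apply/matrixP => a b; rewrite !mxE; ring.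
have colk (v : 'cV[R]_n) a : (v *m delta_mx 0 a) i k = v i 0 * (k == a)%:R.
  by rewrite mxE big_ord1 !mxE eqxx.
move/matrixP/(_ i k); rewrite mxE [X in X + _]mxE !colk.
rewrite eqxx (negPf kj) (negPf kl) mulr1 !mulr0 !addr0 mxE [X in _ + X]mxE.
by rewrite !MSE => /eqP; rewrite mxE subr_eq0 => /eqP.
Qed.

(** Associativity is trivial when one of the three factors is the unit; otherwise
it is [gammaTE] in the components other than the unit, and [unit_coef_assoc] in
the component on the unit. *)
Lemma adjoin_unit_balg : based_algebra (adjoin_unit T).
Proof.
have sC i j l : adjoin_unit T i j l = adjoin_unit T j i l.
  rewrite /adjoin_unit; case: (unliftP ord0 i) => [i'|] ei; last first.
    by case: (unliftP ord0 j) => [j'|] ej; rewrite ?ei ?ej.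
  case: (unliftP ord0 j) => [j'|] ej; last by [].
  by case: unlift => [l'|]; [apply: TC | apply: unit_coef_sym].
split=> // [i j l m|j l]; last by rewrite /adjoin_unit unlift_none.
have sum_delta (p : 'I_n.+1) (F : 'I_n.+1 -> R) :
    \sum_a (p == a)%:R * F a = F p.
  rewrite (bigD1 p) //= eqxx mul1r big1 ?addr0 // => a ap.
  by rewrite eq_sym (negPf ap) mul0r.
have u1 p q : adjoin_unit T ord0 p q = (p == q)%:R.
  by rewrite /adjoin_unit unlift_none.
have u2 p q : adjoin_unit T p ord0 q = (p == q)%:R by rewrite sC u1.
case: (unliftP ord0 i) => [i'|] ->; last first.
  under eq_bigr do rewrite u1.
  under [RHS]eq_bigr do rewrite u1 mulrC eq_sym.
  by rewrite !sum_delta.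
case: (unliftP ord0 l) => [l'|] ->; last first.
  under eq_bigr do rewrite u2 mulrC eq_sym.
  under [RHS]eq_bigr do rewrite u2.
  by rewrite !sum_delta.
case: (unliftP ord0 j) => [j'|] ->; last first.
  under eq_bigr do rewrite u2.
  under [RHS]eq_bigr do rewrite u1.
  by rewrite !sum_delta.
rewrite !big_ord_recl u1 u2.
case: (unliftP ord0 m) => [m'|] ->.
  rewrite !(inj_eq (@lift_inj _ _)) /adjoin_unit unlift_none !liftK.
  under eq_bigr do rewrite !liftK.
  under [X in _ = _ + X]eq_bigr do rewrite !liftK.
  have -> : \sum_a T i' j' a * T a l' m' = \sum_a T j' i' a * T l' a m'.
    by apply: eq_bigr => a _; rewrite (TC i') (TC a).
  have := gammaTE j' i' l' m'; rewrite /gammaT sumrB => /eqP.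
  rewrite subr_eq (unit_coef_sym i') => /eqP ->.
  by rewrite addrA [_ + (_ - _)]addrC subrK.
rewrite /adjoin_unit !unlift_none !liftK.
under eq_bigr do rewrite !liftK (TC i').
under [X in _ = _ + X]eq_bigr do rewrite !liftK (unit_coef_sym i').
rewrite ![lift _ _ == _]eq_sym !(negPf (neq_lift _ _)) !mulr0 !add0r.
exact: unit_coef_assoc.
Qed.

End AdjoinUnit.
End StructureConstants.

(** * The isomorphism of coordinate rings *)
Lemma gammaT_rmorph (R S : comNzRingType) (h : {rmorphism R -> S}) n
    (T : 'I_n -> 'I_n -> 'I_n -> R) i j l m :
  h (gammaT T i j l m) = gammaT (fun i j l => h (T i j l)) i j l m.
Proof.
by rewrite rmorph_sum; apply: eq_bigr => a _; rewrite rmorphB !rmorphM.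
Qed.

Lemma adjoin_unit_rmorph (R S : comNzRingType) (h : {rmorphism R -> S}) n
    (T : 'I_n -> 'I_n -> 'I_n -> R) i j l :
  h (adjoin_unit T i j l) = adjoin_unit (fun i j l => h (T i j l)) i j l.
Proof.
rewrite /adjoin_unit; case: unlift => [i'|]; last exact: rmorph_nat.
case: unlift => [j'|]; last exact: rmorph_nat.
by case: unlift => [l'|] //; rewrite /unit_coef rmorphN gammaT_rmorph.
Qed.

Lemma gammaT_ext (R : comNzRingType) n (T T' : 'I_n -> 'I_n -> 'I_n -> R) i j l m :
  (forall i j l, T i j l = T' i j l) -> gammaT T i j l m = gammaT T' i j l m.
Proof. by move=> TT'; apply: eq_bigr => a _; rewrite !TT'. Qed.

Lemma adjoin_unit_ext (R : comNzRingType) n (T T' : 'I_n -> 'I_n -> 'I_n -> R) i j l :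
  (forall i j l, T i j l = T' i j l) -> adjoin_unit T i j l = adjoin_unit T' i j l.
Proof.
move=> TT'; rewrite /adjoin_unit; case: unlift => // i'; case: unlift => // j'.
by case: unlift => [l'|] //; rewrite /unit_coef (gammaT_ext _ _ _ _ TT').
Qed.

Lemma induces_iso_inv (k : fieldType) (M N : nat) (f : N.-tuple {mpoly k[M]})
    (g : M.-tuple {mpoly k[N]}) (X : idealr {mpoly k[M]}) (Y : idealr {mpoly k[N]}) :
  (forall p, p \in Y -> pi_ideal X (p \mPo f) = 0) ->
  (forall p, p \in X -> pi_ideal Y (p \mPo g) = 0) ->
  (forall p, pi_ideal X ((p \mPo g) \mPo f) = pi_ideal X p) ->
  (forall p, pi_ideal Y ((p \mPo f) \mPo g) = pi_ideal Y p) ->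
  induces_iso f X Y.
Proof.
pose F : {rmorphism {mpoly k[N]} -> {ideal_quot X}} := pi_ideal X \o comp_mpoly f.
pose G : {rmorphism {mpoly k[M]} -> {ideal_quot Y}} := pi_ideal Y \o comp_mpoly g.
move=> fY gX fg gf.
pose phi := quot_lift (fY : forall p, p \in Y -> F p = 0).
pose psi := quot_lift (gX : forall p, p \in X -> G p = 0).
have phiE p : phi (pi_ideal Y p) = pi_ideal X (p \mPo f) by exact: quot_lift_pi.
have psiE p : psi (pi_ideal X p) = pi_ideal Y (p \mPo g) by exact: quot_lift_pi.
exists phi => //; exists psi => x; have [p ->] := pi_ideal_surj x.
  by apply: etrans (congr1 psi (phiE p)) _; rewrite psiE gf.
by apply: etrans (congr1 phi (psiE p)) _; rewrite phiE fg.
Qed.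

Section Isomorphism.
Variables (k : fieldType) (n : nat).
Hypothesis n3 : (2 < n)%N.

(** The two ideals, with the ideal structure made part of their type so that the
quotient rings and their projections are found by inference. *)
Definition based_ideal : idealr {mpoly k[#|svar n|]} := based_algebra_ideal k n.
Definition gamma_ideal : idealr {mpoly k[#|tvar n|]} := polypart (Jideal k n).
Local Notation X := based_ideal.
Local Notation Y := gamma_ideal.
Local Notation piX := (pi_ideal X).
Local Notation piY := (pi_ideal Y).

Definition tpoly (i j l : 'I_n) : {mpoly k[#|tvar n|]} := coordX k (tidx i j l).

(** The polynomial map that adjoins a unit; it sends a point t to a point of the
space of the s_ij^l, and is inverse to the projection on the subschemes. *)
Definition ts_section : #|svar n|.-tuple {mpoly k[#|tvar n|]} :=
  [tuple let x := enum_val r in adjoin_unit tpoly x.1.1 x.1.2 x.2 | r < #|svar n|].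

Local Notation f := (comp_mpoly (st_proj k n)).
Local Notation g := (comp_mpoly ts_section).

Lemma tpoly_sym i j l : tpoly i j l = tpoly j i l.
Proof.
rewrite /tpoly; congr coordX; apply: val_inj; rewrite /= /tsort.
by case: (ltngtP i j) => // ij; have -> : i = j by apply: val_inj.
Qed.

Lemma gamma_tpoly i j l m : gamma k i j l m = mps_of_mpoly (gammaT tpoly i j l m).
Proof. by rewrite gammaT_rmorph. Qed.

Lemma gammaT_tpoly_homog i j l m : gammaT tpoly i j l m \is 2.-homog.
Proof.
have t1 i' j' l' : tpoly i' j' l' \is 1.-homog by rewrite dhomogX /= mdeg1.
apply: rpred_sum => a _; apply: rpredB; exact: (dhomogM (t1 _ _ _) (t1 _ _ _)).
Qed.

Lemma ts_section_sX i j l : g (sX k i j l) = adjoin_unit tpoly i j l.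
Proof. by rewrite comp_mpolyXU -tnth_nth tnth_mktuple enum_rankK. Qed.

Lemma st_proj_coordX x : f (coordX k x) =
  sX k (lift ord0 (val x).1.1) (lift ord0 (val x).1.2) (lift ord0 (val x).2).
Proof. by rewrite comp_mpolyXU -tnth_nth tnth_mktuple enum_rankK. Qed.

(** The universal based algebra. *)
Lemma pi_based_algebra : based_algebra (fun i j l => piX (sX k i j l)).
Proof.
have pi0 p : based_algebra_eqn p -> piX p = 0.
  move=> pG; apply/eqP; rewrite -pi_ideal_eq0; apply/ideal_genP.
  exists [:: (1, p)]; last by rewrite big_seq1 mul1r.
  by move=> q; rewrite inE => /eqP ->.
split=> [i j l|i j l m|j l]; apply/eqP; rewrite -subr_eq0.
- by rewrite -rmorphB; apply/eqP/pi0; constructor.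
- have := pi0 _ (BA_assoc k i j l m); rewrite rmorphB !rmorph_sum => /eqP.
  under eq_bigr do rewrite rmorphM.
  by under [X in _ - X]eq_bigr do rewrite rmorphM.
- by have := pi0 _ (BA_unitl k j l); rewrite rmorphB rmorph_nat => /eqP.
Qed.

(** The universal solution of the gamma relations. *)
Lemma pi_gamma_relations : gamma_relations (fun i j l => piY (tpoly i j l)).
Proof.
have pi0 p : Jgen (mps_of_mpoly p) -> piY p = 0.
  move=> pG; apply/eqP; rewrite -pi_ideal_eq0; apply/ideal_genP.
  exists [:: (1, mps_of_mpoly p)]; last by rewrite big_seq1 mul1r.
  by move=> q; rewrite inE => /eqP ->.
split=> [i j l|i j l m jl jm lm|i j l m jl jm]; rewrite -?(gammaT_rmorph piY tpoly).
- by rewrite tpoly_sym.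
- by rewrite pi0 // -gamma_tpoly; constructor.
- apply/eqP; rewrite -subr_eq0 -rmorphB; apply/eqP/pi0.
  by rewrite rmorphB /= -!gamma_tpoly; constructor.
Qed.

Lemma pi_st_proj_tpoly i j l :
  piX (f (tpoly i j l)) = nonunit_part (fun i j l => piX (sX k i j l)) i j l.
Proof.
rewrite st_proj_coordX /= /tsort; case: leqP => //= _.
exact: balg_comm pi_based_algebra _ _ _.
Qed.

Lemma st_proj_polypart p : p \in Y -> piX (f p) = 0.
Proof.
have TQ := balg_gamma_relations pi_based_algebra.
apply: (kill_polypart (h := piX \o f)) => _ [] i j l m jl jm.
- move=> lm; exists (gammaT tpoly i j l m), 2; split.
  + exact: gamma_tpoly.
  + exact: gammaT_tpoly_homog.
  + by rewrite gammaT_rmorph (gammaT_ext _ _ _ _ pi_st_proj_tpoly) (gamma_distinct TQ).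
- exists (gammaT tpoly i j l l - gammaT tpoly i j m m), 2; split.
  + by rewrite rmorphB !gamma_tpoly.
  + by rewrite rpredB ?gammaT_tpoly_homog.
  + rewrite rmorphB !gammaT_rmorph !(gammaT_ext _ _ _ _ pi_st_proj_tpoly).
    by rewrite (gamma_diff TQ i jl jm) subrr.
Qed.

Lemma ts_section_ideal p : p \in X -> piY (g p) = 0.
Proof.
pose h : {rmorphism {mpoly k[#|svar n|]} -> {ideal_quot Y}} := piY \o g.
have gs i j l : h (sX k i j l)
    = adjoin_unit (fun i j l => piY (tpoly i j l)) i j l.
  by rewrite -(adjoin_unit_rmorph piY tpoly) -ts_section_sX.
have [bC bA b1] := adjoin_unit_balg n3 pi_gamma_relations.
apply: (kill_ideal_gen (h := h)) => _ [i j l|i j l m|j l|i l].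
- by rewrite rmorphB !gs bC subrr.
- rewrite rmorphB !rmorph_sum.
  under eq_bigr do rewrite rmorphM !gs.
  under [X in _ - X]eq_bigr do rewrite rmorphM !gs.
  by rewrite bA subrr.
- by rewrite rmorphB rmorph_nat gs b1 subrr.
- by rewrite rmorphB rmorph_nat gs bC b1 subrr.
Qed.

Lemma st_projK p : g (f p) = p.
Proof.
apply: (mpoly_rmorph_eq (f := g \o f) (g := idfun)) => [c|r] /=.
  by rewrite !comp_mpolyC.
have -> : 'X_r = coordX k (enum_val r) by rewrite /coordX enum_valK.
rewrite st_proj_coordX ts_section_sX /adjoin_unit !liftK.
rewrite /tpoly; congr coordX; apply: val_inj; rewrite /= /tsort.
by case: (enum_val r) => [[[i j] l]]; rewrite /tle /= => ->.
Qed.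

Lemma ts_sectionK p : piX (f (g p)) = piX p.
Proof.
apply: (mpoly_rmorph_eq (f := piX \o f \o g) (g := piX)) => [c|r] /=.
  by rewrite !comp_mpolyC.
have -> : 'X_r = sX k (enum_val r).1.1 (enum_val r).1.2 (enum_val r).2.
  by rewrite /sX /coordX -!surjective_pairing enum_valK.
rewrite ts_section_sX.
apply: etrans (adjoin_unit_rmorph (piX \o f) tpoly _ _ _) _.
rewrite (adjoin_unit_ext _ _ _ pi_st_proj_tpoly).
exact: (adjoin_nonunit_part n3 pi_based_algebra).
Qed.

End Isomorphism.

Theorem theorem5p7 (k : fieldType) (n : nat) :
  [pchar k] =i pred0 -> (3 <= n)%N ->
  induces_iso (st_proj k n) (based_algebra_ideal k n) (polypart (Jideal k n)).
Proof.
move=> _ n3.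
apply: (induces_iso_inv (X := based_ideal k n) (Y := gamma_ideal k n)
  (g := ts_section k n)).
- exact: st_proj_polypart.
- exact: ts_section_ideal.
- exact: ts_sectionK.
- by move=> p; rewrite st_projK.
Qed.
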